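(* Let $n\ge 4$, $1\le k\le n-1$, and let $G$ be a directed approximate $k$-nearest neighbor graph on $n$ observations $\mathbf{y}_1,\dots,\mathbf{y}_n$. For each $t\in\{1,\dots,n-1\}$, let $R_{G,1}(t)$ be the number of edges of $G$ connecting two observations both with time index at most $t$, and $R_{G,2}(t)$ the number of edges of $G$ connecting two observations both with time index greater than $t$. Then the expectations, variances and covariance under the permutation null distribution are $$\mathsf{E}(R_{G,1}(t)) = nk\,p_1(t),\qquad \mathsf{E}(R_{G,2}(t)) = nk\,q_1(t),$$ $$\mathsf{var}(R_{G,1}(t)) = d_1p_1(t)+d_2p_2(t)+d_3p_3(t)-(nk\,p_1(t))^2,$$ $$\mathsf{var}(R_{G,2}(t)) = d_1q_1(t)+d_2q_2(t)+d_3q_3(t)-(nk\,q_1(t))^2,$$ $$\mathsf{cov}(R_{G,1}(t),R_{G,2}(t)) = d_3\,r(t)-(nk\,p_1(t))(nk\,q_1(t)),$$ where $$p_1(t)=\frac{t(t-1)}{n(n-1)},\quad p_2(t)=\frac{t(t-1)(t-2)}{n(n-1)(n-2)},\quad p_3(t)=\frac{t(t-1)(t-2)(t-3)}{n(n-1)(n-2)(n-3)},$$ $$q_1(t)=\frac{(n-t)(n-t-1)}{n(n-1)},\quad q_2(t)=\frac{(n-t)(n-t-1)(n-t-2)}{n(n-1)(n-2)},$$ $$q_3(t)=\frac{(n-t)(n-t-1)(n-t-2)(n-t-3)}{n(n-1)(n-2)(n-3)},\quad r(t)=\frac{t(t-1)(n-t)(n-t-1)}{n(n-1)(n-2)(n-3)},$$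 and $d_1=c^{(1)}+c^{(2)}$, $d_2=c^{(3)}+c^{(4)}+c^{(5)}+c^{(6)}$, $d_3=c^{(7)}$, with $$c^{(1)}=nk,\qquad c^{(2)}=\sum_{i=1}^n\sum_{j\in D_i}\mathbf{1}_{\{(i,j)\in G\}},\qquad c^{(3)}=c^{(4)}=\sum_{i=1}^n\sum_{j\in D_i}\bigl(k-\mathbf{1}_{\{(i,j)\in G\}}\bigr),$$ $$c^{(5)}=nk(k-1),\qquad c^{(6)}=\sum_{i=1}^n\bigl(|D_i|^2-|D_i|\bigr),\qquad c^{(7)}=(nk)^2-\sum_{m=1}^6c^{(m)},$$ where $D_i=\{j:(j,i)\in G\}$ is the set of indices of observations that point toward $\mathbf{y}_i$ and $|D_i|$ is its cardinality (the in-degree of $\mathbf{y}_i$).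
   Context: Directed approximate $k$-nearest neighbor ($k$-NN) graph: $G$ is the set of ordered pairs $(i,j)$, $i\ne j$, $i,j\in\{1,\dots,n\}$, such that $\mathbf{y}_j$ is among the $k$ chosen approximate nearest neighbors of $\mathbf{y}_i$. Each observation selects exactly $k$ distinct other observations (nearby points that need not be the exact $k$ nearest), so every node has out-degree exactly $k$, while in-degrees may vary; there are no self-loops or repeated directed edges, and $|G|=nk$. In the observed order, $R_{G,1}(t)=\sum_{(i,j)\in G}\mathbf{1}_{\{i\le t,\,j\le t\}}$ and $R_{G,2}(t)=\sum_{(i,j)\in G}\mathbf{1}_{\{i>t,\,j>t\}}$. Permutation null distribution: probability $1/n!$ is placed on each of the $n!$ permutations of $\{\mathbf{y}_i:i=1,\dots,n\}$. That is, $G$ is held fixed as a graph on the observations, a uniformly random permutation $\pi$ of $\{1,\dots,n\}$ assigns time index $\pi(i)$ to $\mathbf{y}_i$, and $R_{G,1}(t)=\sum_{(i,j)\in G}\mathbf{1}_{\{\pi(i)\le t,\,\pi(j)\le t\}}$, $R_{G,2}(t)=\sum_{(i,j)\in G}\mathbf{1}_{\{\pi(i)>t,\,\pi(j)>t\}}$. The symbols $\mathsf{E}$, $\mathsf{var}$, $\mathsf{cov}$ denote expectation, variance and covariance under this distribution. *)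

(* Defs.v *)
From mathcomp Require Import all_boot all_order all_fingroup all_algebra.
Set Implicit Arguments.
Unset Strict Implicit.
Unset Printing Implicit Defensive.
Import Order.TTheory GRing.Theory Num.Theory.
Local Open Scope ring_scope.

(* Observations are indexed by 'I_n (0-based), and a graph on them is its set
   of ordered edges.  Since the chosen neighbors need not be the exact nearest
   ones, the only constraints are that every observation selects exactly [k]
   distinct observations other than itself. *)
Definition approx_knn_graph (n k : nat) (G : {set 'I_n * 'I_n}) : Prop :=
  (forall i : 'I_n, (i, i) \notin G) /\
  (forall i : 'I_n, #|[set j : 'I_n | (i, j) \in G]| = k).

(* The successor turns the 0-based ordinal into a time in {1, ..., n}. *)
Definition time_index (n : nat) (s : 'S_n) (i : 'I_n) : nat := (s i).+1.

Definition RG1 (R : realFieldType) (n : nat) (G : {set 'I_n * 'I_n}) (t : nat)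
    (s : 'S_n) : R :=
  \sum_(e in G) ((time_index s e.1 <= t)%N && (time_index s e.2 <= t)%N)%:R.

Definition RG2 (R : realFieldType) (n : nat) (G : {set 'I_n * 'I_n}) (t : nat)
    (s : 'S_n) : R :=
  \sum_(e in G) ((t < time_index s e.1)%N && (t < time_index s e.2)%N)%:R.

(* Moments under the permutation null distribution, which puts mass 1/n! on
   each permutation. *)
Definition Eperm (R : realFieldType) (n : nat) (X : 'S_n -> R) : R :=
  \sum_(s : 'S_n) (n`!%:R)^-1 * X s.

Definition covperm (R : realFieldType) (n : nat) (X Y : 'S_n -> R) : R :=
  Eperm (fun s => (X s - Eperm X) * (Y s - Eperm Y)).

Definition varperm (R : realFieldType) (n : nat) (X : 'S_n -> R) : R :=
  Eperm (fun s => (X s - Eperm X) ^+ 2).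

Definition p1 (R : realFieldType) (n t : nat) : R :=
  (t%:R * (t%:R - 1)) / (n%:R * (n%:R - 1)).

Definition p2 (R : realFieldType) (n t : nat) : R :=
  (t%:R * (t%:R - 1) * (t%:R - 2)) / (n%:R * (n%:R - 1) * (n%:R - 2)).

Definition p3 (R : realFieldType) (n t : nat) : R :=
  (t%:R * (t%:R - 1) * (t%:R - 2) * (t%:R - 3)) /
  (n%:R * (n%:R - 1) * (n%:R - 2) * (n%:R - 3)).

Definition q1 (R : realFieldType) (n t : nat) : R :=
  ((n%:R - t%:R) * (n%:R - t%:R - 1)) / (n%:R * (n%:R - 1)).

Definition q2 (R : realFieldType) (n t : nat) : R :=
  ((n%:R - t%:R) * (n%:R - t%:R - 1) * (n%:R - t%:R - 2)) /
  (n%:R * (n%:R - 1) * (n%:R - 2)).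

Definition q3 (R : realFieldType) (n t : nat) : R :=
  ((n%:R - t%:R) * (n%:R - t%:R - 1) * (n%:R - t%:R - 2) *
     (n%:R - t%:R - 3)) /
  (n%:R * (n%:R - 1) * (n%:R - 2) * (n%:R - 3)).

Definition r (R : realFieldType) (n t : nat) : R :=
  (t%:R * (t%:R - 1) * (n%:R - t%:R) * (n%:R - t%:R - 1)) /
  (n%:R * (n%:R - 1) * (n%:R - 2) * (n%:R - 3)).

Definition in_nbrs (n : nat) (G : {set 'I_n * 'I_n}) (i : 'I_n) : {set 'I_n} :=
  [set j : 'I_n | (j, i) \in G].

(* All subtractions below are taken in [R], never in [nat]. *)
Definition c1 (R : realFieldType) (n k : nat) : R := n%:R * k%:R.

Definition c2 (R : realFieldType) (n : nat) (G : {set 'I_n * 'I_n}) : R :=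
  \sum_(i : 'I_n) \sum_(j in in_nbrs G i) ((i, j) \in G)%:R.

Definition c3 (R : realFieldType) (n k : nat) (G : {set 'I_n * 'I_n}) : R :=
  \sum_(i : 'I_n) \sum_(j in in_nbrs G i) (k%:R - ((i, j) \in G)%:R).

Definition c4 (R : realFieldType) (n k : nat) (G : {set 'I_n * 'I_n}) : R :=
  c3 R k G.

Definition c5 (R : realFieldType) (n k : nat) : R :=
  n%:R * k%:R * (k%:R - 1).

Definition c6 (R : realFieldType) (n : nat) (G : {set 'I_n * 'I_n}) : R :=
  \sum_(i : 'I_n) (#|in_nbrs G i|%:R ^+ 2 - #|in_nbrs G i|%:R).

Definition c7 (R : realFieldType) (n k : nat) (G : {set 'I_n * 'I_n}) : R :=
  (n%:R * k%:R) ^+ 2 -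
  (c1 R n k + c2 R G + c3 R k G + c4 R k G + c5 R n k + c6 R G).

Definition d1 (R : realFieldType) (n k : nat) (G : {set 'I_n * 'I_n}) : R :=
  c1 R n k + c2 R G.

Definition d2 (R : realFieldType) (n k : nat) (G : {set 'I_n * 'I_n}) : R :=
  c3 R k G + c4 R k G + c5 R n k + c6 R G.

Definition d3 (R : realFieldType) (n k : nat) (G : {set 'I_n * 'I_n}) : R :=
  c7 R k G.

(* Main.v *)
(* The square (or product) of edge counts is a sum over pairs of edges, and the
   expectation of a summand depends only on the number (two, three or four) of
   distinct endpoints of the pair; [d1], [d2], [d3] count the pairs of each kind.
   The expectations come from drawing the endpoints one at a time: given the
   labels of the endpoints already drawn, all the others are exchangeable. *)
Require Import Defs.
From mathcomp Require Import all_boot all_order all_fingroup all_algebra.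
From mathcomp Require Import ring.
Import Order.TTheory GRing.Theory Num.Theory.
Local Open Scope ring_scope.

(** * Expectation over uniform permutations, and drawing labels one at a time *)

Section Expectation.
Variables (R : realFieldType) (n : nat).
Implicit Types (X Y : 'S_n -> R) (a b : pred 'I_n) (A : {set 'I_n}).

Lemma eq_Eperm X Y : X =1 Y -> Eperm X = Eperm Y.
Proof. by move=> eqXY; apply: eq_bigr => s _; rewrite eqXY. Qed.

Lemma Eperm_sum (I : finType) (P : pred I) (F : I -> 'S_n -> R) :
  Eperm (fun s => \sum_(i | P i) F i s) = \sum_(i | P i) Eperm (F i).
Proof.
by rewrite /Eperm exchange_big /=; apply: eq_bigr => s _; rewrite mulr_sumr.
Qed.

Lemma EpermZ (c : R) X : Eperm (fun s => c * X s) = c * Eperm X.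
Proof. by rewrite /Eperm mulr_sumr; apply: eq_bigr => s _; rewrite mulrCA. Qed.

Lemma EpermB X Y : Eperm (fun s => X s - Y s) = Eperm X - Eperm Y.
Proof. by rewrite /Eperm -sumrB; apply: eq_bigr => s _; rewrite mulrBr. Qed.

Lemma Eperm_cst (c : R) : Eperm (fun _ : 'S_n => c) = c.
Proof.
rewrite /Eperm sumr_const card_Sn -[LHS]mulr_natr mulrAC mulVf ?mul1r //.
by rewrite pnatr_eq0 -lt0n fact_gt0.
Qed.

Lemma Eperm_mulg (p : 'S_n) X : Eperm (fun s => X (p * s)%g) = Eperm X.
Proof. by rewrite [RHS](reindex_inj (mulgI p)). Qed.

Lemma covpermE X Y :
  covperm X Y = Eperm (fun s => X s * Y s) - Eperm X * Eperm Y.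
Proof.
rewrite /covperm; set x := Eperm X; set y := Eperm Y.
transitivity (Eperm (fun s => X s * Y s - (x * Y s - (x * y - y * X s)))).
  by apply: eq_Eperm => s; ring.
by rewrite !EpermB !EpermZ Eperm_cst -/x -/y; ring.
Qed.

(** One draw: [A] holds the observations already drawn, and wherever [X] is nonzero they carry
    exactly [c] labels from [a]. Swapping [u] with another undrawn observation does not change the
    expectation, and over all [n - #|A|] undrawn observations the indicators add up to
    [#|a| - c]. *)
Lemma Eperm_draw a X A u (c : R) : u \notin A ->
    (forall x y s, x \notin A -> y \notin A -> X (tperm x y * s)%g = X s) ->
    (forall s, X s * \sum_(x in A) (a (s x))%:R = c * X s) ->
  Eperm (fun s => X s * (a (s u))%:R) =
    (#|a|%:R - c) / (n%:R - #|A|%:R) * Eperm X.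
Proof.
move=> uA symX countX.
have leA : (#|A| < n)%N.
  rewrite -[X in (_ < X)%N](card_ord n) -cardsT proper_card // properT.
  by apply: contraNneq uA => ->; rewrite inE.
have nA : n%:R - #|A|%:R != 0 :> R by rewrite subr_eq0 eqr_nat gtn_eqF.
have symE y : y \notin A ->
    Eperm (fun s => X s * (a (s y))%:R) = Eperm (fun s => X s * (a (s u))%:R).
  move=> yA; rewrite -(Eperm_mulg (tperm u y) (fun s => X s * (a (s y))%:R)).
  by apply: eq_Eperm => s; rewrite symX // permM tpermR.
have sumE : Eperm (fun s => \sum_(y | y \notin A) X s * (a (s y))%:R) =
    (#|a|%:R - c) * Eperm X.
  rewrite -EpermZ; apply: eq_Eperm => s; rewrite mulrBl -countX -mulr_sumr.
  rewrite (mulrC #|a|%:R) -mulrBr; congr (_ * _).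
  (* Being a bijection, [s] assigns each label of [a] exactly once. *)
  have -> : #|a|%:R = \sum_x (a (s x))%:R :> R.
    rewrite -sum1_card natr_sum big_mkcond (reindex_inj (@perm_inj _ s)).
    by apply: eq_bigr => x _; rewrite unfold_in; case: (a _).
  by rewrite [X in _ = X - _](bigID (mem A)) /= [X in X - _]addrC addrK.
apply: (mulfI nA); rewrite mulrA mulrCA divff // mulr1 -sumE Eperm_sum.
rewrite (eq_bigr _ symE) sumr_const -[RHS]mulr_natl; congr (_ * _).
rewrite -natrB; last exact: ltnW.
congr (_%:R); rewrite -[RHS](addKn #|A|); congr (_ - _)%N.
by rewrite -[LHS](card_ord n) -(cardC A).
Qed.

(** Draw the entries of [xs] successively: on the event that the earlier ones all landed in [a],
    they have used up as many labels of [a] as there were draws. If [a] is too small, some numerator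
    vanishes, as it should. *)
Lemma Eperm_all a xs : uniq xs ->
  Eperm (fun s => (all (fun x => a (s x)) xs)%:R) =
    \prod_(i < size xs) ((#|a|%:R - i%:R) / (n%:R - i%:R)) :> R.
Proof.
elim: xs => [_|u xs IH /= /andP[uxs Uxs]]; first by rewrite big_ord0 Eperm_cst.
rewrite big_ord_recr /= -IH // mulrC.
have cardA : #|[set x in xs]| = size xs by rewrite cardsE; apply/card_uniqP.
rewrite -[in n%:R - _]cardA -(Eperm_draw _ _ _ u) ?inE //.
- by apply: eq_Eperm => s; rewrite -natrM mulnb andbC.
- move=> x y s; rewrite !inE => xxs yxs; congr (_%:R); congr nat_of_bool.
  apply: eq_in_all => z zxs; rewrite permM tpermD //.
    by apply: contraNneq xxs => ->.
  by apply: contraNneq yxs => ->.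
move=> s; case: allP => [axs|_]; last by rewrite mul0r mulr0.
rewrite mulr1 mul1r (eq_bigr (fun=> 1)); first by rewrite sumr_const cardA.
by move=> x; rewrite inE => /axs ->.
Qed.

(** The draws for [xs] come first. By disjointness they use no label of [b], so they lower only the
    denominators of the second product. *)
Lemma Eperm_all2 a b xs ys : (forall x, a x -> ~~ b x) -> uniq (ys ++ xs) ->
  Eperm (fun s => (all (fun x => a (s x)) xs && all (fun y => b (s y)) ys)%:R) =
    \prod_(i < size xs) ((#|a|%:R - i%:R) / (n%:R - i%:R)) *
    \prod_(j < size ys) ((#|b|%:R - j%:R) / (n%:R - (j + size xs)%:R)) :> R.
Proof.
move=> abF; elim: ys => [Uxs|u ys IH /= /andP[uA UA]].
  by rewrite big_ord0 mulr1 -Eperm_all //; apply: eq_Eperm => s; rewrite andbT.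
rewrite big_ord_recr /= mulrA -IH // mulrC.
have cardA : #|[set x in ys ++ xs]| = (size ys + size xs)%N.
  by rewrite cardsE -size_cat; apply/card_uniqP.
rewrite -[in n%:R - _]cardA -(Eperm_draw _ _ _ u) ?inE //.
- by apply: eq_Eperm => s; rewrite -natrM mulnb andbAC andbA.
- move=> x y s; rewrite !inE => xA yA; congr (_%:R); congr nat_of_bool.
  have tE z : z \in ys ++ xs -> (tperm x y * s)%g z = s z.
    move=> zA; rewrite permM tpermD //.
      by apply: contraNneq xA => ->.
    by apply: contraNneq yA => ->.
  by congr andb; apply: eq_in_all => z zA; rewrite tE // mem_cat zA ?orbT.
move=> s; case: allP => [axs|_]; last by rewrite mul0r mulr0.
case: allP => [bys|_]; last by rewrite mul0r mulr0.
rewrite mulr1 mul1r (eq_bigl (mem (ys ++ xs))); last by move=> x; rewrite inE.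
(* Among the drawn observations, those of [xs] contribute 0 to the count of labels in [b], those of
   [ys] contribute 1 each. *)
rewrite -big_uniq //= big_cat /= [X in _ + X]big_seq [X in _ + X]big1 => [|x].
  rewrite addr0 big_seq (eq_bigr (fun=> 1)) => [|y /bys -> //].
  by rewrite -big_seq big_const_seq count_predT iter_addr_0.
by move=> /axs /abF /negPf ->.
Qed.

End Expectation.

(** * Counting pairs of edges by their number of distinct endpoints *)

Section EdgePairs.
Variables (R : realFieldType) (n k : nat) (G : {set 'I_n * 'I_n}).
Hypothesis knnG : approx_knn_graph k G.
Let g i j : R := ((i, j) \in G)%:R.

Let edge_sum (F : 'I_n * 'I_n -> R) :
  \sum_(e in G) F e = \sum_i \sum_j g i j * F (i, j).
Proof.
rewrite pair_bigA big_mkcond; apply: eq_bigr => -[i j] _ /=; rewrite /g.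
by case: ifP; rewrite ?mul1r ?mul0r.
Qed.

Let out_degree i : \sum_j g i j = k%:R.
Proof.
rewrite /g -natr_sum -(knnG.2 i) -sum1_card [in RHS]big_mkcond /=; congr _%:R.
by apply: eq_bigr => j _; rewrite inE; case: ifP.
Qed.

Let in_degree i : \sum_j g j i = #|in_nbrs G i|%:R.
Proof.
rewrite /g -natr_sum -sum1_card [in RHS]big_mkcond /=; congr _%:R.
by apply: eq_bigr => j _; rewrite inE; case: ifP.
Qed.

Lemma card_knn : #|G|%:R = n%:R * k%:R :> R.
Proof.
rewrite -sum1_card natr_sum edge_sum.
under eq_bigr => i _ do [under eq_bigr => j _ do rewrite mulr1; rewrite out_degree].
by rewrite sumr_const card_ord mulr_natl.
Qed.

Let sum_in_degree : \sum_i #|in_nbrs G i|%:R = n%:R * k%:R :> R.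
Proof.
under eq_bigr => i _ do rewrite -in_degree.
rewrite exchange_big -card_knn -sum1_card natr_sum edge_sum.
by do 2![apply: eq_bigr => ? _]; rewrite mulr1.
Qed.

Let in_nbrs_sum i (F : 'I_n -> R) :
  \sum_(j in in_nbrs G i) F j = \sum_j g j i * F j.
Proof.
rewrite big_mkcond; apply: eq_bigr => j _; rewrite inE /g.
by case: ifP; rewrite ?mul1r ?mul0r.
Qed.

Let c3E : c3 R k G = n%:R * k%:R * k%:R - c2 R G.
Proof.
rewrite /c3 /c2; under eq_bigr => i _ do rewrite sumrB.
rewrite sumrB -sum_in_degree mulr_suml; congr (_ - _).
by apply: eq_bigr => i _; rewrite sumr_const mulr_natl.
Qed.

Let c6E : c6 R G = \sum_i #|in_nbrs G i|%:R ^+ 2 - n%:R * k%:R.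
Proof. by rewrite /c6 sumrB sum_in_degree. Qed.

(** Group the coinciding pairs by the common endpoint [i]; the factors then become out-degrees or
    in-degrees. *)
Let sum_coincidence (p q : 'I_n * 'I_n -> 'I_n) :
  \sum_(e in G) \sum_(f in G) (p e == q f)%:R =
  \sum_i (\sum_(e in G) (p e == i)%:R) * (\sum_(f in G) (q f == i)%:R) :> R.
Proof.
under [RHS]eq_bigr => i _ do rewrite mulr_suml.
rewrite [RHS]exchange_big; apply: eq_bigr => e _ /=.
rewrite (bigD1 (p e)) //= eqxx mul1r [X in _ + X]big1 ?addr0 => [|i /negPf ie].
  by apply: eq_bigr => f _; rewrite eq_sym.
by rewrite eq_sym ie mul0r.
Qed.

Let fiber1 i : \sum_(e in G) (e.1 == i)%:R = k%:R :> R.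
Proof.
rewrite edge_sum (bigD1 i) //= [X in _ + X]big1 ?addr0 => [|j /negPf ji].
  by under eq_bigr => j _ do rewrite eqxx mulr1; apply: out_degree.
by apply: big1 => l _; rewrite ji mulr0.
Qed.

Let fiber2 i : \sum_(e in G) (e.2 == i)%:R = #|in_nbrs G i|%:R :> R.
Proof.
rewrite edge_sum exchange_big (bigD1 i) //= [X in _ + X]big1 ?addr0 => [|j /negPf ji].
  by under eq_bigr => j _ do rewrite eqxx mulr1; apply: in_degree.
by apply: big1 => l _; rewrite ji mulr0.
Qed.

Let sum11 : \sum_(e in G) \sum_(f in G) (e.1 == f.1)%:R = n%:R * k%:R ^+ 2 :> R.
Proof.
rewrite sum_coincidence; under eq_bigr => i _ do rewrite fiber1.
by rewrite sumr_const card_ord -[LHS]mulr_natl expr2.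
Qed.

Let sum12 : \sum_(e in G) \sum_(f in G) (e.1 == f.2)%:R = n%:R * k%:R ^+ 2 :> R.
Proof.
rewrite sum_coincidence; under eq_bigr => i _ do rewrite fiber1 fiber2.
by rewrite -mulr_sumr sum_in_degree; ring.
Qed.

Let sum21 : \sum_(e in G) \sum_(f in G) (e.2 == f.1)%:R = n%:R * k%:R ^+ 2 :> R.
Proof.
rewrite exchange_big -[RHS]sum12.
by do 2![apply: eq_bigr => ? _]; rewrite eq_sym.
Qed.

Let sum22 : \sum_(e in G) \sum_(f in G) (e.2 == f.2)%:R =
  \sum_i #|in_nbrs G i|%:R ^+ 2 :> R.
Proof. by rewrite sum_coincidence; apply: eq_bigr => i _; rewrite fiber2. Qed.

Let sum_same : \sum_(e in G) \sum_(f in G) (e == f)%:R = n%:R * k%:R :> R.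
Proof.
rewrite -card_knn -sum1_card natr_sum; apply: eq_bigr => e eG.
rewrite (bigD1 e) //= eqxx big1 ?addr0 // => f /andP[_ /negPf fe].
by rewrite eq_sym fe.
Qed.

Let sum_reverse :
  \sum_(e in G) \sum_(f in G) (e == (f.2, f.1))%:R = c2 R G.
Proof.
rewrite exchange_big /c2 edge_sum exchange_big; apply: eq_bigr => i _ /=.
rewrite in_nbrs_sum; apply: eq_bigr => j _; congr (_ * _) => /=.
(* For the edge from [j] to [i], the only candidate for its reverse is [(i, j)], which counts when
   it lies in [G]. *)
rewrite big_mkcond (bigD1 (i, j)) //= eqxx big1 ?addr0 => [|e /negPf ->].
  by case: ifP.
by case: ifP.
Qed.

(** Without loops, two edges have two coinciding endpoints exactly when they are equal or reversed.
    Each coincidence changes [P 4] by [P 3 - P 4]; the double ones need the further correction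
    [P 2 + P 4 - 2 * P 3] to reach [P 2]. *)
Lemma edge_pair_sum (P : nat -> R) :
  \sum_(e in G) \sum_(f in G) P (size (undup [:: e.1; e.2; f.1; f.2])) =
  d1 R k G * P 2%N + d2 R k G * P 3%N + d3 R k G * P 4%N.
Proof.
have sumE (c : R) (F : 'I_n * 'I_n -> 'I_n * 'I_n -> R) :
    \sum_(e in G) \sum_(f in G) c * F e f = c * \sum_(e in G) \sum_(f in G) F e f.
  by rewrite mulr_sumr; apply: eq_bigr => e _; rewrite mulr_sumr.
have sumD (F H : 'I_n * 'I_n -> 'I_n * 'I_n -> R) :
    \sum_(e in G) \sum_(f in G) (F e f + H e f) =
    \sum_(e in G) \sum_(f in G) F e f + \sum_(e in G) \sum_(f in G) H e f.
  by rewrite -big_split; apply: eq_bigr => e _; rewrite big_split.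
have loopless e : e \in G -> e.1 != e.2.
  by case: e => i j; apply: contraTneq => /= ->; apply: knnG.1.
(* Inclusion-exclusion over the coincidences of endpoints. *)
transitivity (\sum_(e in G) \sum_(f in G)
    (P 4%N * 1 +
     (P 2%N + P 4%N - 2 * P 3%N) * ((e == f)%:R + (e == (f.2, f.1))%:R) +
     (P 3%N - P 4%N) * ((e.1 == f.1)%:R + (e.1 == f.2)%:R +
                        ((e.2 == f.1)%:R + (e.2 == f.2)%:R)))).
  apply: eq_bigr => -[i j] /loopless /= ij; apply: eq_bigr => -[u v] /loopless /= uv.
  rewrite !xpair_eqE !inE (negPf ij) (negPf uv) /=.
  (* Of the sixteen patterns of coincidence, the inconsistent ones contradict looplessness or
     another comparison; the rest are identities in the values of [P]. *)
  have [iu|iu] := eqVneq i u; have [iv|iv] := eqVneq i v;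
    have [ju|ju] := eqVneq j u; have [jv|jv] := eqVneq j v;
    rewrite /= ?inE ?(negPf uv) /=;
    first [by ring | by move: ij uv; subst; rewrite ?eqxx].
rewrite !sumD !sumE !sumD sum11 sum12 sum21 sum22 sum_same sum_reverse.
have -> : \sum_(e in G) \sum_(f in G) 1 = (n%:R * k%:R) ^+ 2 :> R.
  by rewrite -card_knn expr2 !sumr_const -[LHS]mulr_natr.
by rewrite /d1 /d2 /d3 /c7 /c4 c3E c6E /c1 /c5; ring.
Qed.

End EdgePairs.

(** * Moments of edge counts for arbitrary sets of labels *)

Section EdgeCounts.
Variables (R : realFieldType) (n k : nat) (G : {set 'I_n * 'I_n}).
Hypothesis knnG : approx_knn_graph k G.
Implicit Types a b : pred 'I_n.

Definition edge_count b (s : 'S_n) : R :=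
  \sum_(e in G) (b (s e.1) && b (s e.2))%:R.

(** A ratio of falling factorials: the probability that [m] given distinct observations all receive
    labels from a set of size [N]. *)
Definition ffact_ratio (N m : nat) : R :=
  \prod_(i < m) ((N%:R - i%:R) / (n%:R - i%:R)).

Lemma Eperm_edge_count b :
  Eperm (edge_count b) = n%:R * k%:R * ffact_ratio #|b| 2.
Proof.
rewrite /edge_count Eperm_sum -(card_knn _ _ _ _ knnG) mulr_natl -sumr_const.
apply: eq_bigr => -[i j] ijG /=.
have ij : i != j by apply: contraTneq ijG => ->; apply: knnG.1.
rewrite /ffact_ratio -(Eperm_all _ _ b [:: i; j]) /= ?inE ?ij //.
by apply: eq_Eperm => s; rewrite andbT.
Qed.

Lemma Eperm_edge_countM a b :
  Eperm (fun s => edge_count a s * edge_count b s) =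
  \sum_(e in G) \sum_(f in G)
     Eperm (fun s => [&& a (s e.1), a (s e.2), b (s f.1) & b (s f.2)]%:R).
Proof.
under eq_bigr => e _ do rewrite -Eperm_sum; rewrite -Eperm_sum.
apply: eq_Eperm => s; rewrite mulr_suml; apply: eq_bigr => e _.
by rewrite mulr_sumr; apply: eq_bigr => f _; rewrite -natrM mulnb !andbA.
Qed.

Lemma varperm_edge_count b :
  varperm (edge_count b) =
  d1 R k G * ffact_ratio #|b| 2 + d2 R k G * ffact_ratio #|b| 3 +
  d3 R k G * ffact_ratio #|b| 4 - (n%:R * k%:R * ffact_ratio #|b| 2) ^+ 2.
Proof.
(* The variance is convertible to the covariance of the count with itself. *)
rewrite -[LHS]/(covperm _ _) covpermE Eperm_edge_count Eperm_edge_countM -expr2.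
rewrite -(edge_pair_sum _ _ _ _ knnG); congr (_ - _).
apply: eq_bigr => e _; apply: eq_bigr => f _.
(* Repeated endpoints impose the same condition twice, so only the distinct ones matter. *)
rewrite /ffact_ratio -(Eperm_all _ _ b) ?undup_uniq //; apply: eq_Eperm => s.
by rewrite (eq_all_r (mem_undup _)) /= andbT.
Qed.

(** An endpoint shared by the two edges would need a label in both [a] and [b]. Hence only pairs
    with four distinct endpoints contribute, which leaves [d3] alone. *)
Lemma covperm_edge_count a b : (forall x, a x -> ~~ b x) ->
  covperm (edge_count a) (edge_count b) =
  d3 R k G * \prod_(i < 2) ((#|a|%:R - i%:R) / (n%:R - i%:R)) *
    \prod_(j < 2) ((#|b|%:R - j%:R) / (n%:R - (j + 2)%:R)) -
  n%:R * k%:R * ffact_ratio #|a| 2 * (n%:R * k%:R * ffact_ratio #|b| 2).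
Proof.
move=> abF; rewrite covpermE !Eperm_edge_count Eperm_edge_countM; congr (_ - _).
set c := \prod_(i < 2) _; set d := \prod_(j < 2) _.
transitivity (\sum_(e in G) \sum_(f in G)
    if size (undup [:: e.1; e.2; f.1; f.2]) == 4 then c * d else 0); last first.
  rewrite (edge_pair_sum _ _ _ _ knnG (fun m => if m == 4%N then c * d else 0)) /=.
  by rewrite !mulr0 !add0r mulrA.
have loopless e : e \in G -> e.1 != e.2.
  by case: e => i j; apply: contraTneq => /= ->; apply: knnG.1.
apply: eq_bigr => e eG; apply: eq_bigr => f fG.
have [U|dupl] := boolP (uniq [:: f.1; f.2; e.1; e.2]).
  have U' : uniq [:: e.1; e.2; f.1; f.2].
    by rewrite (uniq_catC [:: e.1; e.2] [:: f.1; f.2]).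
  rewrite undup_id //= -(Eperm_all2 _ _ a b [:: e.1; e.2] [:: f.1; f.2]) //.
  by apply: eq_Eperm => s /=; rewrite !andbT !andbA.
have -> : (size (undup [:: e.1; e.2; f.1; f.2]) == 4) = false.
  apply: ltn_eqF; rewrite (ltn_size_undup [:: e.1; e.2; f.1; f.2]).
  by rewrite (uniq_catC [:: e.1; e.2] [:: f.1; f.2]).
(* The event is empty: if it occurred, the endpoints would be distinct, within each edge by
   looplessness and across the edges by disjointness. *)
rewrite -[RHS](Eperm_cst R n); apply: eq_Eperm => s.
apply/eqP; rewrite pnatr_eq0 eqb0; apply: contra dupl.
case/and4P => a1 a2 b1 b2.
have ab x y : a (s x) -> b (s y) -> y != x.
  by move=> ax; apply: contraTneq => ->; apply: abF.
by rewrite /= !inE !negb_or !loopless //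
   (ab _ _ a1 b1) (ab _ _ a1 b2) (ab _ _ a2 b1) (ab _ _ a2 b2).
Qed.

End EdgeCounts.

(** * Specialization to the labels up to time [t] and after it *)

Theorem theorem1 (R : realFieldType) (n k : nat) (G : {set 'I_n * 'I_n})
    (t : nat) (hn : (4 <= n)%N) (hk : (1 <= k <= n - 1)%N)
    (hG : approx_knn_graph k G) (ht : (1 <= t <= n - 1)%N) :
  [/\ Eperm (RG1 R G t) = n%:R * k%:R * p1 R n t,
      Eperm (RG2 R G t) = n%:R * k%:R * q1 R n t,
      varperm (RG1 R G t) =
        d1 R k G * p1 R n t + d2 R k G * p2 R n t + d3 R k G * p3 R n t
        - (n%:R * k%:R * p1 R n t) ^+ 2,
      varperm (RG2 R G t) =
        d1 R k G * q1 R n t + d2 R k G * q2 R n t + d3 R k G * q3 R n t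
        - (n%:R * k%:R * q1 R n t) ^+ 2 &
      covperm (RG1 R G t) (RG2 R G t) =
        d3 R k G * r R n t
        - (n%:R * k%:R * p1 R n t) * (n%:R * k%:R * q1 R n t)].
Proof.
have tn : (t <= n)%N.
  by case/andP: ht => _ /leq_trans -> //; apply: leq_subr.
have n0 i : (i < 4)%N -> n%:R - i%:R != 0 :> R.
  by move=> i4; rewrite subr_eq0 eqr_nat gtn_eqF // (leq_trans i4).
have := n0 0 isT; rewrite subr0 => n_neq0.
have [n1 n2 n3] := And3 (n0 1 isT) (n0 2 isT) (n0 3 isT).
(* Labels are 0-based, so a time index at most [t] means a label strictly below [t]. *)
pose a := [pred x : 'I_n | (x < t)%N]; pose b := [pred x : 'I_n | (t <= x)%N].
have Na : #|a| = t.
  (* [a] is the image of ['I_t] under the injective widening into ['I_n]. *)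
  rewrite -[RHS]card_ord -(card_image (f := widen_ord tn)); last first.
    by move=> x y /(congr1 val) /= /val_inj.
  apply: eq_card => x; rewrite inE; apply/idP/imageP => [xt|[y _ ->]] //=.
  by exists (Ordinal xt) => //; apply: val_inj.
have Nb : #|b|%:R = n%:R - t%:R :> R.
  have bC : b =i [predC a] by move=> x; rewrite !inE -leqNgt.
  apply: (canRL (addrK _)); rewrite -Na -natrD addnC (eq_card bC).
  by rewrite cardC card_ord.
have abF x : a x -> ~~ b x by rewrite /= -ltnNge.
have RG1E : RG1 R G t = edge_count R n G a by [].
have RG2E : RG2 R G t = edge_count R n G b by [].
rewrite RG1E RG2E !(Eperm_edge_count _ _ _ _ hG) !(varperm_edge_count _ _ _ _ hG).
rewrite (covperm_edge_count _ _ _ _ hG) //.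
rewrite /ffact_ratio Na !big_ord_recr !big_ord0 /= Nb.
rewrite /p1 /p2 /p3 /q1 /q2 /q3 /r.
by split; field; rewrite ?n_neq0 ?n1 ?n2 ?n3.
Qed.
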